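(* Let $q$ be a prime power. Then the map $\phi$ (defined in the context) is an order embedding from $(\mathbb{M}_q,\subseteq)$ to $(\mathcal{T}_q,\subseteq)$, and thus the lattice of monomial clones on $\mathbb{F}_q$ is well-partially ordered, i.e., there is no infinite descending chain of monomial clones on $\mathbb{F}_q$ and there is no infinite antichain of monomial clones on $\mathbb{F}_q$.
   Context: $\mathbb{N}=\{1,2,\dots\}$, $\mathbb{N}_0=\mathbb{N}\cup\{0\}$, $\mathbb{F}_q$ is the field with $q$ elements. A monomial is a formal product $g=\prod_{i\in\mathbb{N}}x_i^{\alpha(i)}$ with $\alpha(i)\in\mathbb{N}_0$, finitely many but at least one $\alpha(i)$ nonzero (so $1$ is not a monomial); $\mathrm{mI}(g)$ is the largest $i$ with $\alpha(i)\neq0$, called the arity of $g$. For $n\ge\mathrm{mI}(g)$ the $n$-ary induced function is $g^{\mathbb{F}_q^n}\colon\mathbb{F}_q^n\to\mathbb{F}_q$, $(x_1,\dots,x_n)\mapsto\prod_{i=1}^nx_i^{\alpha(i)}$. Monomials $m_1,m_2$ are equivalent if the $\mathrm{mI}(m_1)$-ary induced function of $m_1$ equals the $\mathrm{mI}(m_2)$-ary induced function of $m_2$ (i.e. for each $i$ the exponents of $x_i$ in $m_1$ and $m_2$ are equal, or both positive and congruent modulo $q-1$). A clone on a set $A$ is a set of finitary operations on $A$ (of arities $\ge1$) containing all projections and closed under composition. A set $M$ of monomials is a monomial clone on $\mathbb{F}_q$ if $\{m^{\mathbb{F}_q^n}\mid m\in M,\ n\ge\mathrm{mI}(m)\}$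 is a clone on $\mathbb{F}_q$ and $M$ is closed under equivalent monomials. $\mathbb{M}_q$ is the set of all monomial clones on $\mathbb{F}_q$; ordered by inclusion it is a lattice. A set $S\subseteq\mathbb{N}_0^{q-1}$ with $(0,\dots,0)\in S$ is a $q$-minor set if for all $(s_1,\dots,s_{q-1})\in S$ and all $t_1,\dots,t_{q-1}\in\mathbb{N}_0$ with $s_i-t_i(q-1)\ge0$ for all $i\le q-1$, we have $(s_1-t_1(q-1),\dots,s_{q-1}-t_{q-1}(q-1))\in S$. $\mathcal{T}_q$ is the set of all $q$-minor sets. For $C\in\mathbb{M}_q$ let $\overline{C}:=\{\prod_{i=1}^nx_i^{\alpha(i)}\in C\mid n\in\mathbb{N},\ \forall i\le n\colon\alpha(i)\in\{1,\dots,q-1\}\}$. For $m\in\overline{C}$ and $i\in\{1,\dots,q-1\}$ let $\mathcal{N}(m,i)$ be the number of exponents of $m$ equal to $i$. Define $$\phi(C):=\{(\mathcal{N}(m,1),\dots,\mathcal{N}(m,q-1))\in\mathbb{N}_0^{q-1}\mid m\in\overline{C}\}\cup\{(0,\dots,0)\},$$ which is an element of $\mathcal{T}_q$. An order embedding is a map $f$ with $x\le y\iff f(x)\le f(y)$. Infinite descending chain means infinite strictly descending chain. *)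

(* Defs.v *)
From HB Require Import structures.
From mathcomp Require Import all_boot all_order all_algebra finmap.
From mathcomp Require Import all_classical.

Set Implicit Arguments.
Unset Strict Implicit.
Unset Printing Implicit Defensive.

Import GRing.Theory.
Local Open Scope classical_set_scope.

(* Variables are numbered from 0: the exponent of x_(i.+1) is [g i].  The      *)
(* empty product [fsfun] is not a monomial.                                   *)
Record monomial := Monomial {
  expo :> {fsfun nat -> nat with 0};
  _ : expo != [fsfun] }.
HB.instance Definition _ := [isSub for expo].
HB.instance Definition _ := [Choice of monomial by <:].

(* In 1-based numbering this is the largest i such that x_i occurs in g.      *)
Definition mI (g : monomial) : nat := \max_(i <- finsupp g) i.+1.

Definition induced (F : finFieldType) (n : nat) (g : monomial) :
    n.-tuple F -> F :=
  fun x => (\prod_(i < n) tnth x i ^+ g i)%R.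
Arguments induced F n g : clear implicits.

(* Functions of different arities are different, hence the first conjunct.    *)
Definition mequiv (F : finFieldType) (m1 m2 : monomial) : Prop :=
  mI m1 = mI m2 /\ induced F (mI m1) m1 = induced F (mI m1) m2.

(* [C n] is the set of n-ary operations of C; arities are at least 1.         *)
Definition is_clone (A : Type) (C : forall n, set (n.-tuple A -> A)) : Prop :=
  [/\ C 0 = set0,
      forall n (i : 'I_n), C n (fun x => tnth x i) &
      forall m n (f : m.-tuple A -> A) (g : 'I_m -> n.-tuple A -> A),
        C m f -> (forall i, C n (g i)) -> C n (fun x => f [tuple g i x | i < m])].

Definition induced_ops (F : finFieldType) (M : set monomial) (n : nat) :
    set (n.-tuple F -> F) :=
  [set induced F n m | m in [set m | M m /\ mI m <= n]].

Arguments induced_ops F M n : clear implicits.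

Definition monomial_clones (F : finFieldType) : set (set monomial) :=
  [set M | is_clone (induced_ops F M) /\
           forall m1 m2, M m1 -> mequiv F m1 m2 -> M m2].

(* The coordinate of index [i : 'I_q.-1] is the (i.+1)-th one.                *)
Definition minor_sets (q : nat) : set (set {ffun 'I_q.-1 -> nat}) :=
  [set S | S [ffun=> 0] /\
     forall s t : {ffun 'I_q.-1 -> nat}, S s ->
       (forall i, t i * q.-1 <= s i) -> S [ffun i => s i - t i * q.-1]].

Arguments minor_sets q : clear implicits.

Definition reduced (q : nat) (C : set monomial) : set monomial :=
  [set m | C m /\ forall i, i < mI m -> 1 <= m i <= q.-1].

Definition num_expo (m : monomial) (i : nat) : nat :=
  #|[pred j : 'I_(mI m) | m j == i]|.

Definition phi (q : nat) (C : set monomial) : set {ffun 'I_q.-1 -> nat} :=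
  [set [ffun i : 'I_q.-1 => num_expo m i.+1] | m in reduced q C]
    `|` [set [ffun=> 0]].

Arguments phi q C : clear implicits.

Definition order_embedding (T U : Type) (P : set (set T)) (Q : set (set U))
    (f : set T -> set U) : Prop :=
  set_fun P Q f /\
  forall C D, P C -> P D -> (C `<=` D <-> f C `<=` f D).

Definition infinite_descending_chain (T : Type) (P : set (set T)) : Prop :=
  exists c : nat -> set T, forall n, P (c n) /\ c n.+1 `<` c n.

Definition infinite_antichain (T : Type) (P : set (set T)) : Prop :=
  exists A : set (set T),
    [/\ A `<=` P, infinite_set A &
        forall C D, A C -> A D -> C `<=` D -> C = D].

Definition well_partially_ordered (T : Type) (P : set (set T)) : Prop :=
  ~ infinite_descending_chain P /\ ~ infinite_antichain P.

(* Main.v *)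
Require Import Defs.
From mathcomp Require Import all_boot all_order all_algebra all_field finmap.
From mathcomp Require Import all_classical.
From mathcomp Require Import zify.

(** Embedding.  Write d = q - 1.  As x ^ d = 1 for every nonzero x in the
    field, a monomial function depends only on which variables occur and on
    their exponents modulo d.  Substituting variables for variables in a member
    of a monomial clone sums the exponents of the variables that are identified,
    so a clone is closed under every substitution of this kind
    ([clone_minor]).  Two consequences carry the first half.
    - Membership of m in a clone depends only on the multiset of the exponents
      of m reduced to {1, ..., d} ([clone_profile]); this multiset is what a
      vector of [phi] records, and every monomial shares it with a monomial
      whose exponents are reduced ([exists_reduced]).  Hence the clone can be
      recovered from its image, monotonically.
    - If the removed exponents add up to a multiple of d, all their variables
      may be identified with one remaining variable without changing its
      exponent modulo d ([clone_identify]).  Removing t_i * d variables of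
      exponent i has this property, so the image is a minor set.

    Well partial order.  Call an order wqo if every infinite sequence has
    a term below a later one; this excludes infinite descending chains and
    infinite antichains, and passes back along order embeddings.  It remains
    to show that minor sets are wqo under inclusion.  Splitting according to the
    residues modulo d turns a minor set into a finite family of downsets of
    N^d for the componentwise order.  Wqo of an order does not in general give
    wqo of its downsets, so Dickson's lemma does not suffice.  Instead, a downset
    of N^(k+1) is viewed as the descending sequence of its slices, which are
    downsets of N^k, and the main step [wqo_descending] shows that descending
    sequences over a wqo are wqo for the pointwise order.  This is a variant of
    Higman's lemma: a descending sequence becomes stationary, hence is
    a finite word followed by a limit, and the minimal bad sequence
    argument of Nash-Williams applies. *)

Set Implicit Arguments.
Unset Strict Implicit.
Unset Printing Implicit Defensive.

Import GRing.Theory.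
Local Open Scope classical_set_scope.

(** * Well-quasi-orders and minimal bad sequences *)

Definition wqo_on (T : Type) (A : set T) (R : T -> T -> Prop) : Prop :=
  forall f : nat -> T, (forall n, A (f n)) ->
    exists i j, i < j /\ R (f i) (f j).

Definition bad_seq (T : Type) (A : set T) (R : T -> T -> Prop)
    (f : nat -> T) : Prop :=
  (forall n, A (f n)) /\ forall i j, i < j -> ~ R (f i) (f j).

Lemma wqo_onP (T : Type) (A : set T) (R : T -> T -> Prop) :
  (forall f, ~ bad_seq A R f) -> wqo_on A R.
Proof.
move=> nobad f Af; apply: contrapT => nR; apply: (nobad f); split=> // i j ij Rij.
by apply: nR; exists i, j.
Qed.

Lemma increasing_iterates (g : nat -> nat) (i0 : nat) :
  (forall i, i < g i) -> {homo (fun n => iter n g i0) : i j / i < j}.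
Proof. by move=> gP; apply: (homo_ltn ltn_trans) => i; apply: gP. Qed.

(** Indices whose term lies below no later term cannot be unbounded, since
    the terms at such indices would form a bad sequence; beyond a bound, one can
    always step to a later and larger term. *)
Lemma monotone_subsequence (T : Type) (A : set T) (R : T -> T -> Prop)
    (f : nat -> T) :
  (forall x y z, R x y -> R y z -> R x z) ->
  wqo_on A R -> (forall n, A (f n)) ->
  exists2 s : nat -> nat, {homo s : i j / i < j} &
    forall i j, i < j -> R (f (s i)) (f (s j)).
Proof.
move=> Rtr Awqo Af.
pose terminal i := forall j, i < j -> ~ R (f i) (f j).
have [[N NP]|unb] := pselect (exists N, forall i, N <= i -> ~ terminal i).
  have /choice[g gP] : forall i, exists j, N <= i -> i < j /\ R (f i) (f j).
    move=> i; have [Ni|Ni] := boolP (N <= i); last by exists 0.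
    have /existsNP[j /not_implyP[ij /contrapT Rij]] := NP i Ni.
    by exists j.
  have iterN n : N <= iter n g N.
    by elim: n => //= n IHn; case: (gP _ IHn) => /ltnW/(leq_trans IHn).
  exists (fun n => iter n g N).
    by apply: (homo_ltn ltn_trans) => i; case: (gP _ (iterN i)).
  apply: (@homo_ltn _ (fun n => f (iter n g N))) => [y x z|i]; first exact: Rtr.
  by case: (gP _ (iterN i)).
have /choice[g gP] : forall N, exists i, N < i /\ terminal i.
  move=> N; apply: contrapT => nt; apply: unb; exists N.+1 => i Ni ti.
  by apply: nt; exists i.
pose s n := iter n g (g 0).
have s_incr : {homo s : i j / i < j}.
  by apply: increasing_iterates => i; case: (gP i).
have [i [j [ij Rij]]] := Awqo (f \o s) (fun n => Af _).
have ti : terminal (s i).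
  by rewrite /s; case: (i) => [|n] /=; [have [] := gP 0|have [] := gP (s n)].
by case: (ti _ (s_incr _ _ ij)).
Qed.

(** Gives finite products of wqos: successive extractions make all the
    components listed in r monotone at once. *)
Lemma monotone_subsequence_fin (I : eqType) (T : Type) (A : set T)
    (R : T -> T -> Prop) (f : nat -> I -> T) (r : seq I) :
  (forall x y z, R x y -> R y z -> R x z) ->
  wqo_on A R -> (forall n i, A (f n i)) ->
  exists2 s : nat -> nat, {homo s : i j / i < j} &
    forall x i j, x \in r -> i < j -> R (f (s i) x) (f (s j) x).
Proof.
move=> Rtr Awqo Af; elim: r => [|x r [s s_incr sP]]; first by exists id.
have [u u_incr uP] :=
  monotone_subsequence Rtr Awqo (fun n => Af (s n) x).
exists (s \o u) => [i j /u_incr/s_incr //|y i j].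
by rewrite inE => /predU1P[->|yr] ij /=; [apply: uP|apply/sP/u_incr].
Qed.

Lemma exists_least (P : nat -> Prop) :
  (exists n, P n) -> exists2 n, P n & forall m, P m -> n <= m.
Proof.
move=> [n Pn]; have exP : exists n, `[< P n >] by exists n; apply/asboolP.
case: (ex_minnP exP) => m /asboolP Pm mP; exists m => // k Pk.
by apply: mP; apply/asboolP.
Qed.

(** The terms are chosen one after the other, each of least possible size
    among the bad sequences that extend the terms chosen so far. *)
Lemma minimal_bad_seq (T : Type) (A : set T) (R : T -> T -> Prop)
    (size : T -> nat) (f : nat -> T) :
  bad_seq A R f ->
  exists2 h, bad_seq A R h &
    forall n g, bad_seq A R g -> (forall i, i < n -> g i = h i) ->
      size (h n) <= size (g n).
Proof.
move=> fbad.
pose agree n (g g' : nat -> T) := forall i, i < n -> g i = g' i.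
have /choice[step stepP] : forall nf : nat * (nat -> T), exists g,
    bad_seq A R nf.2 ->
    [/\ bad_seq A R g, agree nf.1 g nf.2 &
      forall g', bad_seq A R g' -> agree nf.1 g' nf.2 ->
        size (g nf.1) <= size (g' nf.1)].
  case=> n {fbad}f /=; have [fbad|] := pselect (bad_seq A R f); last by exists f.
  have [|_ [g [gbad gf <-]] gmin] := @exists_least
    (fun k => exists g, [/\ bad_seq A R g, agree n g f & size (g n) = k]).
    by exists (size (f n)), f.
  by exists g => _; split=> // g' g'bad g'f; apply: gmin; exists g'.
(* G n is a bad sequence whose terms up to index n are final; the minimal
   sequence is the diagonal. *)
pose G := fix G n := if n is m.+1 then step (n, G m) else step (0, f).
have Gbad n : bad_seq A R (G n).
  elim: n => [|n IHn] /=; first by have [] := stepP (0, f) fbad.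
  by have [] := stepP (n.+1, G n) IHn.
have Gagree n k : agree n.+1 (G (n + k)) (G n).
  elim: k => [|k IHk] i ilt; first by rewrite addn0.
  have [_ agr _] := stepP ((n + k).+1, _) (Gbad (n + k)).
  rewrite addnS /= agr; first exact: IHk.
  by rewrite (leq_trans ilt) // ltnS leq_addr.
have Gdiag i n : i <= n -> G i i = G n i.
  by move=> ilen; rewrite -(subnKC ilen) Gagree.
exists (fun n => G n n) => [|[|n] g gbad gG].
- split=> [n|i j ij]; first by case: (Gbad n).
  by rewrite (Gdiag i j (ltnW ij)); exact: (Gbad j).2 ij.
- by have [_ _ min0] := stepP (0, f) fbad; apply: min0.
- have [_ _ minS] := stepP (n.+1, G n) (Gbad n); apply: minS => // i ilt.
  by rewrite (gG _ ilt) (Gdiag i n).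
Qed.

(** * Descending sequences over a well-quasi-order *)

Section Descending.
Variables (T : Type) (A : set T) (R : T -> T -> Prop).
Hypothesis Rrefl : forall x, R x x.
Hypothesis Rtr : forall x y z, R x y -> R y z -> R x z.
Hypothesis Awqo : wqo_on A R.

Definition descending : set (nat -> T) :=
  [set u | (forall i, A (u i)) /\ forall i, R (u i.+1) (u i)].

Definition pointwise (u v : nat -> T) : Prop := forall i, R (u i) (v i).

(** Expresses that the limit of u lies below the limit of v for sequences that
    become stationary.  In this form it is visibly insensitive to dropping initial
    terms. *)
Definition limit_le (u v : nat -> T) : Prop :=
  forall j, exists i, R (u i) (v j).

Definition stable_from (u : nat -> T) (n : nat) : Prop :=
  forall i, n <= i -> R (u n) (u i).

Definition shift (u : nat -> T) : nat -> T := fun i => u i.+1.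

Lemma descending_le u i j : descending u -> i <= j -> R (u j) (u i).
Proof.
move=> [_ udesc] /subnKC <-; elim: (j - i) => [|k IHk]; first by rewrite addn0.
by rewrite addnS; apply: Rtr (udesc _) IHk.
Qed.

Lemma shift_descending u : descending u -> descending (shift u).
Proof. by move=> [Au udesc]; split=> i; [apply: Au|apply: udesc]. Qed.

(** Otherwise u has a strictly descending subsequence, and the wqo provides
    a term of it that lies below a later one. *)
Lemma descending_stabilizes u : descending u -> exists n, stable_from u n.
Proof.
move=> udesc; apply: contrapT => nstab.
have /choice[g gP] : forall n, exists i, n < i /\ ~ R (u n) (u i).
  move=> n; apply: contrapT => nex; apply: nstab; exists n => i.
  rewrite leq_eqVlt => /predU1P[<- //|ni]; apply: contrapT => nRi.
  by apply: nex; exists i.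
have [g_incr gR] : (forall n, n < g n) /\ forall n, ~ R (u n) (u (g n)).
  by split=> n; case: (gP n).
have [i [j [ij Rij]]] := Awqo (f := fun n => u (iter n g 0)) (fun n => udesc.1 _).
apply: (gR (iter i g 0)); apply: (Rtr Rij); rewrite -iterS.
apply: descending_le => //; move: ij; rewrite leq_eqVlt => /predU1P[<- //|ij].
exact/ltnW/increasing_iterates.
Qed.

(** The minimal bad sequence argument is applied to the relation S that
    demands the pointwise comparison only when the limits compare; limits being
    wqo, S suffices.  For S, the limits of a bad sequence increase.
    Dropping the first term of a sequence h n shortens its nonstationary part,
    leaves its limit unchanged and gives a sequence below h n, while the first
    terms can be made increasing by passing to a subsequence. *)
Lemma wqo_descending : wqo_on descending pointwise.
Proof.
pose S u v := limit_le u v -> pointwise u v.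
have /choice[len lenP] : forall u, exists n, descending u ->
    stable_from u n /\ forall m, stable_from u m -> n <= m.
  move=> u; have [ud|] := pselect (descending u); last by exists 0.
  by have [n nP nmin] := exists_least (descending_stabilizes ud); exists n.
have Swqo : wqo_on descending S.
  apply: wqo_onP => f0 /(minimal_bad_seq len)[h [hdesc hbad] hmin].
  have hlim i j : i < j -> limit_le (h i) (h j).
    by move=> /hbad/not_implyP[].
  (* A constant h i is its own limit, so it lies below h i.+1. *)
  have len_gt0 i : 0 < len (h i).
    rewrite lt0n; apply/eqP => len0; have [+ _] := lenP _ (hdesc i).
    rewrite len0 => stab; apply: (hbad _ _ (ltnSn i)) => lim j.
    have [k Rkj] := lim j.
    apply: Rtr Rkj; apply: Rtr (stab k isT).
    exact: descending_le.
  have len_shift i : len (shift (h i)) < len (h i).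
    have [stab _] := lenP _ (hdesc i).
    have [_ minsh] := lenP _ (shift_descending (hdesc i)).
    rewrite -(prednK (len_gt0 i)) ltnS; apply: minsh => j lej.
    by rewrite /shift (prednK (len_gt0 i)); apply: stab; lia.
  have [s s_incr sP] :=
    monotone_subsequence Rtr Awqo (f := fun n => h n 0) (fun n => (hdesc n).1 0).
  (* Minimality of h at s 0 is contradicted: g starts like h and goes on with
     the tails of the h (s n). *)
  pose g n := if n < s 0 then h n else shift (h (s (n - s 0))).
  have gdesc n : descending (g n).
    by rewrite /g; case: ifP => _; [apply: hdesc|apply/shift_descending/hdesc].
  have [gbad|/not_andP[//|]] := pselect (bad_seq descending S g).
    have /(_ _)/wrap[|] := hmin (s 0) g gbad.
      by move=> i ilt; rewrite /g ilt.
    by rewrite /g ltnn subnn leqNgt len_shift.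
  move=> /existsNP[i] /existsNP[j] /not_implyP[ij] /contrapT.
  have s_ge n : s 0 <= s n by case: n => // n; apply/ltnW/s_incr.
  rewrite /g; case: ltnP => [ilt|ige]; case: ltnP => [jlt|jge].
  - exact: hbad.
  - set m := s _; have im : i < m by apply: leq_trans ilt (s_ge _).
    move=> Sim; apply: (hbad _ _ im) => lim k.
    apply: Rtr (Sim _ k) _; last exact: (hdesc m).2.
    by move=> l; apply: lim.
  - by have := leq_trans jlt (leq_trans ige (ltnW ij)); rewrite ltnn.
  - have sij : i - s 0 < j - s 0 by lia.
    set a := s _; set b := s _ => Sab.
    have ab : a < b by apply: s_incr.
    apply: (hbad _ _ ab) => lim [|k]; first exact: sP.
    apply: Sab => l; have [k' Rk'] := lim l.+1.
    by exists k'; apply: Rtr Rk'; apply: (hdesc a).2.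
(* Back from S to the pointwise order, along a subsequence with increasing
   limits. *)
move=> f fdesc.
have [s s_incr sP] := monotone_subsequence Rtr Awqo
  (f := fun n => f n (len (f n))) (fun n => (fdesc n).1 _).
have [i [j [ij Sij]]] := Swqo (f \o s) (fun n => fdesc _).
exists (s i), (s j); split; [exact: s_incr|apply: Sij => k].
exists (len (f (s i))); apply: Rtr (sP _ _ ij) _.
have [stab _] := lenP _ (fdesc (s j)).
have [le|/ltnW le] := leqP (len (f (s j))) k; first exact: stab.
exact: descending_le (fdesc (s j)) le.
Qed.

End Descending.

(** * Downsets of N^k and minor sets *)

(** Vectors of length k are lists, so that the slice of a downset at a first
    coordinate i is obtained by consing i. *)
Definition downset (k : nat) : set (set (seq nat)) :=
  [set S | forall a b, size a = k -> size b = k ->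
     (forall i, nth 0 a i <= nth 0 b i) -> S b -> S a].

Definition subset_len (k : nat) (S S' : set (seq nat)) : Prop :=
  forall a, size a = k -> S a -> S' a.

(** The slices of a downset of N^(k+1) form a descending sequence of downsets
    of N^k, and inclusion is the pointwise inclusion of slices. *)
Lemma wqo_downset k : wqo_on (downset k) (subset_len k).
Proof.
elim: k => [|k IHk] f fdown.
  have [f1|nf1] := pselect (f 1 [::]).
    by exists 0, 1; split=> // a /size0nil ->.
  by exists 1, 2; split=> // a /size0nil ->.
pose slice n i : set (seq nat) := [set a | f n (i :: a)].
have [||n|i [j [ij Rij]]] := wqo_descending _ _ IHk (f := slice).
- by move=> S a.
- by move=> S S' S'' SS' S'S'' a ka /(SS' _ ka)/(S'S'' _ ka).
- split=> i.
    move=> a b ka kb ab; apply: fdown; rewrite /= ?ka ?kb //.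
    by case=> [|l] /=.
  move=> a ka; apply: fdown; rewrite /= ?ka //.
  by case=> [|l] /=.
exists i, j; split=> // -[//|x a] [ka]; exact: Rij.
Qed.

(** The vectors of a minor set with given residues r modulo q - 1 are
    r + (q - 1) a with a ranging over a downset; there are finitely many r. *)
Lemma wqo_minor_sets q : 1 < q -> wqo_on (minor_sets q) subset.
Proof.
move=> q_gt1 f fminor; have d_gt0 : 0 < q.-1 by lia.
pose part n (r : {ffun 'I_q.-1 -> 'I_q.-1}) : set (seq nat) :=
  [set a | f n [ffun i => r i + nth 0 a i * q.-1]].
have [|n r|s s_incr sP] := monotone_subsequence_fin
    (enum {ffun 'I_q.-1 -> 'I_q.-1}) _ (@wqo_downset q.-1) (f := part).
- by move=> S S' S'' SS' S'S'' a ka /(SS' _ ka)/(S'S'' _ ka).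
- move=> a b ka kb ab fb.
  have [_ /(_ _ [ffun i : 'I__ => nth 0 b i - nth 0 a i] fb) fsub] := fminor n.
  rewrite /part /=; set v := [ffun i => _].
  suff -> : v = [ffun i => [ffun j => r j + nth 0 b j * q.-1] i -
      [ffun i : 'I__ => nth 0 b i - nth 0 a i] i * q.-1].
    apply: fsub => i; rewrite !ffunE (leq_trans _ (leq_addl _ _)) //.
    by rewrite leq_mul2r leq_subr orbT.
  apply/ffunP => i; rewrite !ffunE -addnBA ?leq_mul2r ?leq_subr ?orbT //.
  by rewrite -mulnBl subKn.
exists (s 0), (s 1); split=> [|x fx]; first exact: s_incr.
have modq i : x i %% q.-1 < q.-1 by apply: ltn_pmod.
pose r := [ffun i => Ordinal (modq i)].
pose a := [seq x i %/ q.-1 | i <- enum 'I_q.-1].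
have xE : x = [ffun i => r i + nth 0 a i * q.-1].
  apply/ffunP => i; rewrite !ffunE /= (nth_map i) ?size_enum_ord //.
  by rewrite nth_ord_enum addnC -divn_eq.
rewrite xE; apply: (sP r 0 1 _ isT a); first by rewrite mem_enum.
  by rewrite size_map size_enum_ord.
by rewrite /part /= -xE.
Qed.

(** * From wqo to well partial order *)

Lemma order_embedding_wqo (T U : Type) (P : set (set T)) (Q : set (set U)) f :
  order_embedding P Q f -> wqo_on Q subset -> wqo_on P subset.
Proof.
move=> [fPQ femb] Qwqo c Pc.
have [i [j [ij /femb sub]]] := Qwqo (f \o c) (fun n => fPQ _ (Pc n)).
by exists i, j; split=> //; apply: sub.
Qed.

Lemma wqo_well_partially_ordered (T : Type) (P : set (set T)) :
  wqo_on P subset -> well_partially_ordered P.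
Proof.
move=> Pwqo; split=> [[c cP]|[A [AP /infiniteP/pcard_leP[f] antiA]]].
  have [i [j [ij cij]]] := Pwqo c (fun n => (cP n).1).
  have [_ [_ /(_ _)]] := cP i; apply; apply: subset_trans cij _.
  rewrite -(subnKC ij); elim: (j - i.+1) => [|k IHk]; first by rewrite addn0.
  by rewrite addnS; apply: subset_trans IHk; case: (cP (i.+1 + k)) => _ [].
have Af n : A (f n) by apply: funS.
have [i [j [ij fij]]] := Pwqo f (fun n => AP _ (Af n)).
have /inj : f i = f j by apply: antiA.
by rewrite !inE => /(_ I I) ije; rewrite ije ltnn in ij.
Qed.

(** * Monomials and their lists of exponents *)

(** Forces x ^ a = x ^ b for all x, including x = 0, in a field whose nonzero
    elements satisfy x ^ d = 1. *)
Definition same_power (d a b : nat) : Prop :=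
  (a == 0) = (b == 0) /\ a = b %[mod d].

Definition expos (m : monomial) : seq nat := mkseq m (mI m).

Lemma ltn_mI (m : monomial) i : m i != 0 -> i < mI m.
Proof.
move=> mi; rewrite /mI (big_fsetD1 i) ?leq_maxl //=.
by rewrite mem_finsupp.
Qed.

Lemma monomial_eq0 (m : monomial) i : mI m <= i -> m i = 0.
Proof. by move=> le; apply: contraTeq le => /ltn_mI; rewrite ltnNge. Qed.

Lemma mI_le (m : monomial) n : (forall i, n <= i -> m i = 0) -> mI m <= n.
Proof.
move=> m0; apply/bigmax_leqP_seq => i; rewrite mem_finsupp => mi _.
by rewrite ltnNge; apply: contra mi => /m0 ->.
Qed.

Lemma finsupp_neq0 (m : monomial) : finsupp m != fset0.
Proof.
case: m => m /=; apply: contraNneq => m0; apply/eqP/fsfunP => i.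
by rewrite [RHS]fsfunE; apply/eqP; rewrite -memNfinsupp m0.
Qed.

Lemma nth_expos m i : nth 0 (expos m) i = m i.
Proof.
have [lt|le] := ltnP i (mI m); first by rewrite nth_mkseq.
by rewrite nth_default ?size_mkseq // monomial_eq0.
Qed.

Lemma num_expo_count m i : num_expo m i = count_mem i (expos m).
Proof.
rewrite /num_expo cardE size_filter /expos /mkseq -val_enum_ord !count_map.
exact: eq_count.
Qed.

Lemma monomial_of_expos e : e != [::] -> 0 \notin e ->
  exists m, expos m = e.
Proof.
case: e => // x e _ e0.
pose f : {fsfun nat -> nat with 0} :=
  [fsfun i in [fset i in iota 0 (size (x :: e))]%fset => nth 0 (x :: e) i].
have fE i : f i = nth 0 (x :: e) i.
  rewrite fsfunE; case: ifP => //; rewrite in_fset mem_iota /= add0n.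
  by move=> /negbT; rewrite -leqNgt => le; rewrite nth_default.
have f0 : f != [fsfun].
  apply/eqP => /(congr1 (fun g : {fsfun nat -> nat with 0} => g 0)).
  by rewrite fE fsfunE /= => x0; rewrite x0 inE eqxx in e0.
exists (Monomial f0).
have mIE : mI (Monomial f0) = size (x :: e).
  apply/eqP; rewrite eqn_leq mI_le /= => [|i le]; last by rewrite fE nth_default.
  apply: ltn_mI; rewrite /= fE.
  by apply: contraNneq e0 => <-; rewrite mem_nth //=.
apply: (@eq_from_nth _ 0); first by rewrite size_mkseq.
by move=> i _; rewrite nth_expos /= fE.
Qed.

(** The representative of a nonzero exponent in {1, ..., d}; 0 is not
    available because it would lose the variable. *)
Definition reduce_expo (d e : nat) : nat := (e.-1 %% d).+1.

Lemma reduce_expo_id d e : 0 < e <= d -> reduce_expo d e = e.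
Proof. by case: e => // e /= ed; rewrite /reduce_expo modn_small. Qed.

Lemma reduce_expo_bounds d e : 0 < d -> 0 < reduce_expo d e <= d.
Proof. by move=> d_gt0; rewrite /= ltn_mod. Qed.

Lemma same_power_reduce d a b : a != 0 -> b != 0 ->
  reduce_expo d a = reduce_expo d b -> same_power d a b.
Proof.
case: a b => [|a] [|b] // _ _ [ab]; split=> //.
by rewrite -addn1 -[b.+1]addn1; apply/eqP; rewrite eqn_modDr; apply/eqP.
Qed.

(** To be read as a multiset: the order of the support has no meaning. *)
Definition profile (d : nat) (m : monomial) : seq nat :=
  [seq reduce_expo d (m i) | i <- finsupp m].

Definition reduced_expos (d : nat) (e : seq nat) : bool :=
  all (fun x => 0 < x <= d) e.

Lemma reduced_expos_notin0 d e : reduced_expos d e -> 0 \notin e.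
Proof. by move=> /allP e_red; apply/negP => /e_red. Qed.

Lemma reducedP (q : nat) (C : set monomial) m :
  reduced q C m <-> C m /\ reduced_expos q.-1 (expos m).
Proof.
split=> -[Cm]; last first.
  move=> /allP mred; split=> // i lt; apply: mred.
  by rewrite -nth_expos mem_nth ?size_mkseq.
move=> mred; split=> //; apply/allP => x /mapP[i].
by rewrite mem_iota => lt ->; apply: mred.
Qed.

(** A monomial with reduced exponents involves all the variables up to its
    arity, and reduction does not change its exponents. *)
Lemma profile_reduced d m : reduced_expos d (expos m) ->
  perm_eq (profile d m) (expos m).
Proof.
move=> /allP mred.
have mredi i : i < mI m -> 0 < m i <= d.
  by move=> lt; apply: mred; rewrite -nth_expos mem_nth ?size_mkseq.
apply: (@perm_trans _ [seq reduce_expo d (m i) | i <- iota 0 (mI m)]).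
  apply/perm_map/uniq_perm; rewrite ?fset_uniq ?iota_uniq // => i.
  rewrite mem_iota mem_finsupp add0n /=.
  by apply/idP/idP => [/ltn_mI //|/mredi/andP[+ _]]; rewrite lt0n.
suff -> : [seq reduce_expo d (m i) | i <- iota 0 (mI m)] = expos m by [].
by apply/eq_in_map => i; rewrite mem_iota add0n => /mredi/reduce_expo_id.
Qed.

Lemma reduced_perm d e1 e2 : reduced_expos d e1 -> reduced_expos d e2 ->
  (forall i : 'I_d, count_mem i.+1 e1 = count_mem i.+1 e2) -> perm_eq e1 e2.
Proof.
move=> red1 red2 e12.
have : reduced_expos d (e1 ++ e2) by rewrite /reduced_expos all_cat; apply/andP.
move=> /allP red12; apply/allP => x /red12; case: x => // x lt.
exact/eqP/(e12 (Ordinal lt)).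
Qed.

Definition expos_of_counts (d : nat) (s : 'I_d -> nat) : seq nat :=
  flatten [seq nseq (s i) i.+1 | i : 'I_d].

Lemma count_expos_of_counts d (s : 'I_d -> nat) (i : 'I_d) :
  count_mem i.+1 (expos_of_counts s) = s i.
Proof.
rewrite count_flatten -map_comp sumnE big_map big_enum /= (bigD1 i) //=.
rewrite count_nseq /= eqxx mul1n big1 ?addn0 // => j /negPf ji.
by rewrite count_nseq /= eqSS val_eqE ji.
Qed.

Lemma expos_of_counts_reduced d (s : 'I_d -> nat) :
  reduced_expos d (expos_of_counts s).
Proof.
apply/allP => x /flattenP[e /mapP[i _ ->]].
by rewrite mem_nseq => /andP[_ /eqP ->] /=.
Qed.

Lemma dvdn_sumn_expos_of_counts d (t : 'I_d -> nat) :
  d %| sumn (expos_of_counts (fun i => t i * d)).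
Proof.
rewrite sumn_flatten -map_comp sumnE big_map; apply: dvdn_sum => i _ /=.
by rewrite sumn_nseq mulnCA dvdn_mull // dvdn_mull.
Qed.

(** * Monomial clones *)

Section MonomialClones.
Variable F : finFieldType.
Local Notation d := (#|F|.-1).

Lemma d_gt0 : 0 < d.
Proof. by rewrite -subn1 subn_gt0 card_finNzRing_gt1. Qed.

Lemma expr_same_power a b (x : F) : same_power d a b -> (x ^+ a = x ^+ b)%R.
Proof.
move=> [ab0 abd]; have [->|x0] := eqVneq x 0%R; first by rewrite !expr0n ab0.
have xd : (x ^+ d = 1)%R.
  apply: (mulfI x0); rewrite -exprS mulr1 prednK ?expf_card //.
  exact: ltnW (card_finNzRing_gt1 F).
by rewrite -(expr_mod a xd) abd expr_mod.
Qed.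

(** Evaluation at the point with coordinate 0 at i and 1 elsewhere detects
    whether the variable i occurs in m. *)
Lemma induced_test n (m : monomial) (i : 'I_n) :
  induced F n m [tuple (if j == i then 0 else 1)%R | j < n] = (0 ^+ m i)%R.
Proof.
rewrite /induced (bigD1 i) //= tnth_mktuple eqxx big1 ?mulr1 // => j /negPf ji.
by rewrite tnth_mktuple ji expr1n.
Qed.

(** Equality of induced functions at some arity gives equal supports by
    evaluation at test points, hence equal arities; equality at the lower arity
    follows by putting 1 for the missing variables. *)
Lemma induced_mequiv n (m1 m2 : monomial) : mI m1 <= n -> mI m2 <= n ->
  induced F n m1 = induced F n m2 -> mequiv F m1 m2.
Proof.
move=> le1 le2 m12.
have m120 i : (m1 i == 0) = (m2 i == 0).
  have [lt|le] := ltnP i n; last by rewrite !monomial_eq0 // (leq_trans _ le).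
  have := induced_test m1 (Ordinal lt); rewrite m12 induced_test => /eqP.
  rewrite /= !expr0n; case: (m1 i == 0); case: (m2 i == 0) => //.
    by rewrite eq_sym oner_eq0.
  by rewrite oner_eq0.
have mIE : mI m1 = mI m2.
  apply/eqP; rewrite eqn_leq; apply/andP.
  by split; apply: mI_le => i /monomial_eq0/eqP; [rewrite -m120|rewrite m120] => /eqP.
split=> //; apply: funext => x.
pose y := [tuple nth 1%R x i | i < n].
have ext m : mI m = mI m1 -> induced F (mI m1) m x = induced F n m y.
  move=> mm1; rewrite /induced.
  under [LHS]eq_bigr do rewrite (tnth_nth 1%R).
  rewrite (big_ord_widen n (fun i => nth 1 x i ^+ m i)%R) //.
  rewrite big_mkcond /=; apply: eq_bigr => i _; rewrite tnth_mktuple.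
  case: ltnP => // le; rewrite [m i]monomial_eq0 // mm1.
  exact: le.
by rewrite !ext // m12.
Qed.

Variable M : set monomial.
Hypothesis Mclone : monomial_clones F M.

(** Replacing each variable i of m1 by the variable t i composes the operation
    with projections and yields, up to equivalence, m2. *)
Lemma clone_minor (m1 m2 : monomial) (t : nat -> nat) : M m1 ->
  (forall j, same_power d (\sum_(i < mI m1 | t i == j) m1 i) (m2 j)) -> M m2.
Proof.
move=> Mm1 m12; have [[_ proj comp] Meq] := Mclone.
have m2_gt0 : 0 < mI m2.
  have /fset0Pn[i] := finsupp_neq0 m2; rewrite mem_finsupp => /ltn_mI.
  exact: leq_ltn_trans.
(* t may leave the range of variables of m2 only where m1 has exponent 0, so
   its value there does not matter. *)
pose s (i : 'I_(mI m1)) : 'I_(mI m2) := insubd (Ordinal m2_gt0) (t i).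
have sP (i : 'I_(mI m1)) (j : 'I_(mI m2)) : m1 i != 0 -> (s i == j) = (t i == j).
  move=> mi; have lt : t i < mI m2.
    apply: ltn_mI; have [<- _] := m12 (t i).
    rewrite sum_nat_eq0; apply: contra mi => /forallP/(_ i).
    by rewrite eqxx.
  by rewrite /s -[LHS]val_eqE val_insubd lt.
have := comp _ (mI m2) _ (fun i x => tnth x (s i)) (ex_intro2 _ _ m1 _ erefl)
  (fun i => proj _ _).
move=> /(_ (conj Mm1 (leqnn _)))[m [Mm mI_m]] mE.
apply: Meq Mm _; apply: induced_mequiv mI_m (leqnn _) _; rewrite mE.
apply: funext => x; rewrite /induced.
under eq_bigr do rewrite tnth_mktuple.
rewrite (partition_big s xpredT) //=; apply: eq_bigr => j _.
rewrite -(expr_same_power (tnth x j) (m12 j)) expr_sum.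
rewrite [LHS]big_mkcond [RHS]big_mkcond; apply: eq_bigr => i _.
have [->|/sP <-] := eqVneq (m1 i) 0; first by rewrite !expr0 !if_same.
by case: eqP => // <-.
Qed.

(** The case where t is a bijection between the supports. *)
Lemma clone_rename (m1 m2 : monomial) (t : nat -> nat) : M m1 ->
  (forall i, m1 i != 0 -> same_power d (m1 i) (m2 (t i))) ->
  (forall i j, m1 i != 0 -> m1 j != 0 -> t i = t j -> i = j) ->
  (forall j, m2 j != 0 -> exists2 i, m1 i != 0 & t i = j) -> M m2.
Proof.
move=> Mm1 m12 t_inj t_onto; apply: (clone_minor (t := t) Mm1) => j.
have [m2j|/t_onto[i mi tij]] := eqVneq (m2 j) 0.
  rewrite m2j big1 // => i /eqP tij; apply/eqP/negP => /negP mi.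
  by have [] := m12 i mi; rewrite tij m2j (negPf mi).
rewrite (bigD1 (Ordinal (ltn_mI mi))) /= ?tij // big1 ?addn0.
  by rewrite -tij; apply: m12.
move=> k /andP[/eqP tkj ki]; apply: contraNeq ki => mk.
by apply/eqP/val_inj/t_inj => //=; rewrite tkj.
Qed.

(** A permutation matching the two lists of reduced exponents provides
    a bijection between the supports that respects exponents modulo d. *)
Lemma clone_profile (m1 m2 : monomial) :
  perm_eq (profile d m1) (profile d m2) -> M m1 -> M m2.
Proof.
move=> /(perm_iotaP 0)[r r_perm r_eq] Mm1.
set s1 := enum_fset (finsupp m1); set s2 := enum_fset (finsupp m2).
have mem1 i : (i \in s1) = (m1 i != 0) by rewrite -mem_finsupp.
have mem2 i : (i \in s2) = (m2 i != 0) by rewrite -mem_finsupp.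
have uniq1 : uniq s1 by apply: fset_uniq.
have uniq2 : uniq s2 by apply: fset_uniq.
have size_r : size r = size s1.
  by have := congr1 size r_eq; rewrite !size_map.
have mem_r k : (k \in r) = (k < size s2).
  by rewrite (perm_mem r_perm) mem_iota size_map.
have uniq_r : uniq r by rewrite (perm_uniq r_perm) iota_uniq.
pose t i := nth 0 s2 (nth 0 r (index i s1)).
have lt_r i : i \in s1 -> nth 0 r (index i s1) < size s2.
  by move=> i1; rewrite -mem_r mem_nth // size_r index_mem.
apply: (clone_rename (t := t) Mm1) => [i|i j|j]; rewrite -?mem1.
- move=> i1; apply: same_power_reduce; rewrite -?mem1 -?mem2 ?mem_nth ?lt_r //.
  have := congr1 (fun e => nth 0 e (index i s1)) r_eq.
  rewrite (nth_map 0) ?index_mem // nth_index // => ->.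
  by rewrite (nth_map 0) ?size_r ?index_mem // (nth_map 0) ?lt_r.
- move=> i1 j1 /eqP; rewrite nth_uniq ?lt_r // nth_uniq ?size_r ?index_mem //.
  by move=> /eqP/(congr1 (nth 0 s1)); rewrite !nth_index.
- rewrite -mem2 => j2; pose k := index (index j s2) r.
  have k_lt : k < size s1 by rewrite -size_r index_mem mem_r index_mem.
  exists (nth 0 s1 k); first by rewrite -mem1 mem_nth.
  by rewrite /t index_uniq // nth_index ?mem_r ?index_mem // nth_index.
Qed.

(** The variables with exponents in e are identified with the variable 0 of m2,
    whose exponent grows by a multiple of d. *)
Lemma clone_identify (m1 m2 : monomial) (e : seq nat) :
  0 \notin expos m2 -> expos m1 = expos m2 ++ e -> d %| sumn e ->
  M m1 -> M m2.
Proof.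
move=> m2_n0 m12 e_dvd Mm1.
have mI1 : mI m1 = mI m2 + size e.
  by have := congr1 size m12; rewrite size_cat !size_mkseq.
have m2_gt0 : 0 < mI m2.
  have /fset0Pn[i] := finsupp_neq0 m2; rewrite mem_finsupp => /ltn_mI.
  exact: leq_ltn_trans.
(* A variable absent from m2 could not absorb the exponents in e. *)
have m20 : m2 0 != 0.
  apply: contraNneq m2_n0 => <-.
  by rewrite -nth_expos mem_nth ?size_mkseq.
pose t i := if i < mI m2 then i else 0.
suff sumE j : \sum_(i < mI m1 | t i == j) m1 i = m2 j + (j == 0) * sumn e.
  apply: (clone_minor (t := t) Mm1) => j; rewrite sumE; split.
    by rewrite addn_eq0; case: j => [|j]; rewrite ?(negPf m20) ?mul0n ?andbT.
  by rewrite -modnDmr -modnMmr (eqP e_dvd) muln0 mod0n addn0.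
rewrite -(big_mkord (fun i => t i == j) m1) mI1.
rewrite (@big_cat_nat _ _ _ (mI m2)) ?leq_addr //=; congr (_ + _).
  rewrite big_mkord.
  under eq_big => [i|i _].
    rewrite /t ltn_ord; over.
    rewrite -nth_expos m12 nth_cat size_mkseq ltn_ord nth_expos; over.
  have [lt|le] := ltnP j (mI m2).
    by rewrite (big_pred1 (Ordinal lt)).
  rewrite (monomial_eq0 le) big1 // => i /eqP ij.
  by have := ltn_ord i; rewrite ij ltnNge le.
rewrite -{1}[mI m2]add0n big_addn addKn sumnE [in RHS](big_nth 0) big_distrr /=.
rewrite big_mkcond /=; apply: eq_bigr => i _.
rewrite /t ltnNge leq_addl /= eq_sym -nth_expos m12 nth_cat size_mkseq.
by rewrite ltnNge leq_addl /= addnK; case: (j == 0); rewrite ?mul1n.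
Qed.

Lemma exists_reduced (m : monomial) :
  exists2 m', reduced_expos d (expos m') &
    perm_eq (profile d m) (profile d m').
Proof.
have pred : reduced_expos d (profile d m).
  by apply/allP => x /mapP[i _ ->]; apply/reduce_expo_bounds/d_gt0.
have [|m' m'E] := @monomial_of_expos (profile d m) _ (reduced_expos_notin0 pred).
  have := finsupp_neq0 m; apply: contraNneq => /(congr1 size) /eqP.
  by rewrite size_map cardfs_eq0.
exists m'; first by rewrite m'E.
by rewrite -m'E perm_sym profile_reduced ?m'E.
Qed.

(** * The map phi *)

Lemma mem_phi (s : {ffun 'I_d -> nat}) (C : set monomial) :
  phi #|F| C s <-> s = [ffun=> 0] \/
    exists2 m, C m /\ reduced_expos d (expos m) &
      forall i : 'I_d, s i = count_mem i.+1 (expos m).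
Proof.
split=> [[[m /reducedP mC <-]| ->]|[->|[m /reducedP mC sE]]]; [right| by left| |].
- by exists m => // i; rewrite ffunE num_expo_count.
- by right.
- by left; exists m => //; apply/ffunP => i; rewrite ffunE num_expo_count sE.
Qed.

(** A monomial whose exponents have counts s is split into the variables to keep
    and t i * d variables of each exponent i.+1 to remove; the latter can be
    identified with any of the former, and there is one unless the resulting
    vector is 0, which belongs to every minor set. *)
Lemma phi_minor_set : minor_sets #|F| (phi #|F| M).
Proof.
split=> [|s t /mem_phi[-> le|[m [Mm mred] sE] le]]; first by right.
  by right; apply/ffunP => i; rewrite !ffunE sub0n.
set s' := [ffun i => _]; have [->|s'0] := eqVneq s' [ffun=> 0]; first by right.
apply/mem_phi; right.
pose e1 := expos_of_counts s'; pose e2 := expos_of_counts (fun i => t i * d).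
have e1red : reduced_expos d e1 by apply: expos_of_counts_reduced.
have e2red : reduced_expos d e2 by apply: expos_of_counts_reduced.
have e12red : reduced_expos d (e1 ++ e2).
  by rewrite /reduced_expos all_cat; apply/andP.
have e1_neq0 : e1 != [::].
  apply: contraNneq s'0 => e10; apply/eqP/ffunP => i; rewrite [RHS]ffunE.
  by rewrite -count_expos_of_counts -/e1 e10.
have [m1 m1E] := monomial_of_expos e1_neq0 (reduced_expos_notin0 e1red).
have [|m2 m2E] := monomial_of_expos _ (reduced_expos_notin0 e12red).
  by case: (e1) e1_neq0.
have Mm2 : M m2.
  apply: clone_profile Mm; apply: perm_trans (profile_reduced mred) _.
  rewrite perm_sym; apply: perm_trans (profile_reduced _) _; rewrite m2E //.
  apply: reduced_perm e12red mred _ => i.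
  rewrite count_cat !count_expos_of_counts -sE ffunE subnK //.
exists m1; last by move=> i; rewrite m1E count_expos_of_counts.
split; last by rewrite m1E.
apply: (clone_identify (e := e2) _ _ _ Mm2); rewrite ?m1E ?m2E //.
  exact: reduced_expos_notin0 e1red.
exact: dvdn_sumn_expos_of_counts.
Qed.

End MonomialClones.

(** For the reflection of the order, a monomial of C is replaced by a reduced
    one m' with the same profile; the count vector of m' is nonzero, so it is
    realised by a reduced monomial of D, whose exponents are those of m' up to
    order. *)
Lemma phi_order_embedding (F : finFieldType) :
  order_embedding (monomial_clones F) (minor_sets #|F|) (phi #|F|).
Proof.
split=> [C Cclone|C D Cclone Dclone]; first exact: phi_minor_set Cclone.
split=> [CD s /mem_phi sC|phiCD m Cm].
  apply/mem_phi; case: sC => [->|[m [Cm mred] sE]]; [by left|right].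
  by exists m => //; split=> //; apply: CD.
have [m' m'red mm'] := exists_reduced F m.
have Cm' : C m' by apply: (clone_profile Cclone) Cm.
suff Dm' : D m' by apply: (clone_profile Dclone) Dm'; rewrite perm_sym.
pose s := [ffun i : 'I_#|F|.-1 => count_mem i.+1 (expos m')].
have /phiCD/mem_phi[s0|[m1 [Dm1 m1red] sE]] : phi #|F| C s.
- by apply/mem_phi; right; exists m' => // i; rewrite ffunE.
- have [i] := fset0Pn _ (finsupp_neq0 m').
  rewrite mem_finsupp => m'i.
  have m'iE : m' i \in expos m'.
    by rewrite -nth_expos mem_nth // size_mkseq ltn_mI.
  have /andP[_ lt] := allP m'red _ m'iE.
  have lt' : (m' i).-1 < #|F|.-1 by rewrite prednK // lt0n.
  have /ffunP/(_ (Ordinal lt')) := s0; rewrite !ffunE /= prednK ?lt0n //.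
  by move/eqP; rewrite eqn0Ngt -has_count has_pred1 m'iE.
- apply: (clone_profile Dclone) Dm1.
  apply: perm_trans (profile_reduced m1red) _.
  rewrite perm_sym; apply: perm_trans (profile_reduced m'red) _.
  by apply: reduced_perm m'red m1red _ => i; rewrite -sE ffunE.
Qed.

Theorem theorem6p3 (q p k : nat) (p_prime : prime p) (k_gt0 : 0 < k)
    (q_def : q = p ^ k) (F : finFieldType) (cardF : #|F| = q) :
  order_embedding (monomial_clones F) (minor_sets q) (phi q) /\
  well_partially_ordered (monomial_clones F).
Proof.
rewrite -cardF; split; first exact: phi_order_embedding.
apply/wqo_well_partially_ordered/(order_embedding_wqo (phi_order_embedding F)).
exact/wqo_minor_sets/card_finNzRing_gt1.
Qed.
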